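(* A connected graph $G$ is proportionally $(2,4)$-choosable if and only if $G = P_n$ where $n \leq 5$ or $n = 7$.
   Context: All graphs are nonempty, finite and simple. $P_n$ denotes the path on $n$ vertices ($n\in\mathbb{N}=\{1,2,3,\ldots\}$); equality $G=P_n$ means $G$ is isomorphic to $P_n$. For $m\in\mathbb{N}$, $[m]=\{1,\ldots,m\}$. For integers $1\le k\le \ell$, a $(k,\ell)$-assignment for a graph $G$ is a function $L$ assigning to each vertex $v$ of $G$ a set $L(v)\subseteq[\ell]$ with $|L(v)|=k$. Let $\mathcal{L}=\bigcup_{v\in V(G)}L(v)$ and, for $c\in\mathcal{L}$, let $\eta(c)=|\{v\in V(G): c\in L(v)\}|$. A proportional $L$-coloring of $G$ is a function $f$ on $V(G)$ with $f(v)\in L(v)$ for every $v$, with $f(u)\ne f(v)$ whenever $u,v$ are adjacent, and with $|f^{-1}(c)|\in\{\lfloor \eta(c)/k\rfloor,\lceil \eta(c)/k\rceil\}$ for every $c\in\mathcal{L}$. $G$ is proportionally $(k,\ell)$-choosable if a proportional $L$-coloring of $G$ exists for every $(k,\ell)$-assignment $L$ for $G$. *)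

(* Defs.v *)
From mathcomp Require Import all_boot.

Set Implicit Arguments.
Unset Strict Implicit.
Unset Printing Implicit Defensive.

(* A simple graph is an adjacency relation on its finite type of vertices. *)
Definition simple_graph (T : finType) (adj : rel T) : Prop :=
  symmetric adj /\ irreflexive adj.

Definition connected_graph (T : finType) (adj : rel T) : Prop :=
  0 < #|T| /\ forall u v : T, connect adj u v.

Definition graph_iso (T U : finType) (adjT : rel T) (adjU : rel U) : Prop :=
  exists2 h : T -> U,
    bijective h & forall u v : T, adjU (h u) (h v) = adjT u v.

Definition path_graph (n : nat) : rel 'I_n :=
  fun i j => (i.+1 == j) || (j.+1 == i).

Definition ceil_div (m d : nat) : nat := (m + d.-1) %/ d.

Section ProportionalChoosability.

(* The colors 1, ..., l are represented by the l elements 0, ..., l - 1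
   of 'I_l. *)
Variables (T : finType) (adj : rel T) (k l : nat).
Implicit Type L : T -> {set 'I_l}.

Definition list_assignment L : Prop := forall v : T, #|L v| = k.

Definition palette L : {set 'I_l} := \bigcup_(v : T) L v.

Definition multiplicity L (c : 'I_l) : nat := #|[set v : T | c \in L v]|.

Definition proportional_coloring L (f : T -> 'I_l) : Prop :=
  [/\ forall v : T, f v \in L v,
      forall u v : T, adj u v -> f u != f v
    & forall c : 'I_l, c \in palette L ->
        let m := #|[set v : T | f v == c]| in
        m = multiplicity L c %/ k \/ m = ceil_div (multiplicity L c) k].

(* Meaningful for 1 <= k <= l. *)
Definition proportionally_choosable : Prop :=
  forall L, list_assignment L ->
    exists f : T -> 'I_l, proportional_coloring L f.

End ProportionalChoosability.

(* Main.v *)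
Require Import Defs.
From mathcomp Require Import all_boot zify.

Set Implicit Arguments.
Unset Strict Implicit.
Unset Printing Implicit Defensive.

(* A star with three leaves whose lists are all {0, 1} (every other list being
   {2, 3}) cannot be colored in a balanced way, so a choosable graph has maximum
   degree at most 2, and a connected one is a path or a cycle.  Two adjacent
   vertices with the same list must use each of its colors once, so that
   prepending them to a bad assignment of a path leaves it bad: bad assignments
   of P_6 and P_9 thus yield bad ones for all paths, and a fortiori all cycles,
   on 6 or at least 8 vertices.  The remaining cycles C_3, C_4, C_5, C_7 have
   explicit bad assignments, and the remaining paths are checked
   exhaustively. *)

(** * Words of lists along a path and their balanced colorings *)

(* A list assignment along a path is encoded as a word of increasing pairs of
   natural numbers, and a coloring as a sequence of numbers: these evaluate
   well, unlike {set 'I_4}. *)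
Definition color_pairs : seq (nat * nat) :=
  [:: (0, 1); (0, 2); (0, 3); (1, 2); (1, 3); (2, 3)].

Definition pair_has (x : nat) (p : nat * nat) : bool :=
  (x == p.1) || (x == p.2).

Definition neqn (x y : nat) : bool := x != y.

Definition extensible (x : nat) (c : seq nat) : bool :=
  if c is y :: _ then x != y else true.

Definition extend (p : nat * nat) (cs : seq (seq nat)) : seq (seq nat) :=
  [seq x :: c | x <- [:: p.1; p.2], c <- [seq c <- cs | extensible x c]].

(** Filtering at each extension, from the last vertex back to the first, discards improper colorings
    early. *)
Definition colorings (w : seq (nat * nat)) : seq (seq nat) :=
  foldr extend [:: [::]] w.

(* For m uses of a color lying in e lists, this says that m is e / 2 rounded
   down or up. *)
Definition halves (e m : nat) : bool := (e <= m.*2.+1) && (m.*2 <= e.+1).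

(* The list counts es are bound outside the function so that evaluation shares
   them among all colorings of w. *)
Definition balanced (w : seq (nat * nat)) : pred (seq nat) :=
  let es := [seq count (pair_has x) w | x <- iota 0 4] in
  fun c => all (fun x => halves (nth 0 es x) (count_mem x c)) (iota 0 4).

Definition colorable (w : seq (nat * nat)) : bool :=
  has (balanced w) (colorings w).

Fixpoint words (n : nat) : seq (seq (nat * nat)) :=
  if n is n'.+1 then [seq p :: w | p <- color_pairs, w <- words n']
  else [:: [::]].

Lemma halvesP (e m : nat) :
  (m = e %/ 2 \/ m = ceil_div e 2) <-> halves e m.
Proof. rewrite /halves /ceil_div; lia. Qed.

Lemma balancedP (w : seq (nat * nat)) (c : seq nat) :
  reflect (forall x, x < 4 -> halves (count (pair_has x) w) (count_mem x c))
          (balanced w c).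
Proof.
apply: (iffP allP) => [H x lt_x4 | H x].
  have := H x; rewrite mem_iota /= => /(_ lt_x4).
  by rewrite -[[:: _; _; _; _]]/[seq count (pair_has y) w | y <- iota 0 4]
             (nth_map 0) ?size_iota // nth_iota.
rewrite mem_iota /= => lt_x4.
rewrite -[[:: _; _; _; _]]/[seq count (pair_has y) w | y <- iota 0 4].
by rewrite (nth_map 0) ?size_iota // nth_iota //; apply: H.
Qed.

Lemma mem_colorings (w : seq (nat * nat)) (c : seq nat) :
  (c \in colorings w) =
  all2 (fun p x => pair_has x p) w c && sorted neqn c.
Proof.
elim: w c => [|p w IHw] c; first by case: c.
apply/allpairsPdep/idP => [[x] [c' [x_p]] |].
  rewrite mem_filter IHw => /andP[ext_x /andP[w_c' sorted_c']] -> /=.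
  rewrite w_c' andbT; apply/andP; split.
    by move: x_p; rewrite !inE.
  by case: c' ext_x sorted_c' {w_c'} => //= y c'; rewrite /neqn => ->.
case: c => // x c /= /andP[/andP[x_p w_c] path_c].
exists x, c; split => //; first by rewrite !inE.
rewrite mem_filter IHw w_c (path_sorted path_c) !andbT.
by case: c path_c {w_c} => //= y c /andP[].
Qed.

Lemma mem_words (w : seq (nat * nat)) :
  {subset w <= color_pairs} -> w \in words (size w).
Proof.
elim: w => [|p w IHw] sub_w //.
rewrite -[words (size (p :: w))]
  /[seq a :: w' | a <- color_pairs, w' <- words (size w)].
apply/allpairsPdep; exists p, w.
split=> //; first by apply: sub_w; rewrite mem_head.
by apply: IHw => q w_q; apply: sub_w; rewrite inE w_q orbT.
Qed.

(** * Words without balanced colorings, for paths and cycles *)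

(* Adjacent vertices with equal lists take both colors, so they can be removed. *)
Lemma colorable_cons2 (w : seq (nat * nat)) :
  colorable [:: (0, 1), (0, 1) & w] -> colorable w.
Proof.
case/hasP => c; rewrite mem_colorings.
case: c => [|x [|y c]] //=; rewrite ?andbF //.
case/andP => /and3P[x01 y01 w_c] /andP[neq_xy path_c] /balancedP bal_c.
apply/hasP; exists c; first by rewrite mem_colorings w_c (path_sorted path_c).
apply/balancedP => z /bal_c /=; move: x01 y01 neq_xy.
rewrite /pair_has /neqn /halves /=; lia.
Qed.

Lemma uncolorable_word (n : nat) :
  n = 6 \/ 8 <= n ->
  exists w, [/\ size w = n, {subset w <= color_pairs} & ~~ colorable w].
Proof.
have extend_word k w : ~~ colorable w -> {subset w <= color_pairs} ->
    exists w', [/\ size w' = k.*2 + size w, {subset w' <= color_pairs}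
                 & ~~ colorable w'].
  move=> bad_w sub_w; elim: k => [|k [w' [size_w' sub_w' bad_w']]].
    by exists w.
  exists [:: (0, 1), (0, 1) & w']; split.
  - by rewrite /= size_w' doubleS.
  - by move=> p; rewrite !in_cons => /or3P[/eqP->|/eqP->|/sub_w'].
  - by apply: contra bad_w'; apply: colorable_cons2.
(* Counting positions from 1: each of 1, 2, 3 is used once, so 0 occurs at one of the positions 1,
   3, one of 2, 5 and one of 4, 6. Position 2 is next to 1 and 3, so 0 is at 5, which is next to 4
   and 6. *)
pose w6 := [:: (0, 1); (0, 2); (0, 1); (0, 3); (0, 2); (0, 3)].
(* Color 3 is used once, so 0 is at position 6 or 8 and position 7 gets 2. Colors 1 and 2 are used
   twice each. If position 9 gets 2, then positions 2 and 4 get 0, so 1, 3, 5 all get color 1. If it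
   gets 1, then position 2 or 4 gets 0 and both its neighbors get 1. Either way 1 is used three
   times. *)
pose w9 := [:: (0, 1); (0, 2); (0, 1); (0, 2); (0, 1); (0, 3); (0, 2); (0, 3);
               (1, 2)].
have bad6 : ~~ colorable w6 by vm_compute.
have bad9 : ~~ colorable w9 by vm_compute.
(* Prepending preserves parity, which selects the base word; an odd [n] is at least 9 here. *)
move=> n_large; case odd_n: (odd n).
  have -> : n = (n - 9)./2.*2 + size w9 by rewrite /=; lia.
  by apply: extend_word => //; apply/allP.
have -> : n = (n - 6)./2.*2 + size w6 by rewrite /=; lia.
by apply: extend_word => //; apply/allP.
Qed.

(** The ends of the word count as adjacent, as on a cycle. *)
Definition closed_colorable (w : seq (nat * nat)) : bool :=
  has (fun c => balanced w c && (head 0 c != last 0 c)) (colorings w).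

Lemma closed_uncolorable_word (n : nat) :
  3 <= n <= 5 \/ n = 7 ->
  exists w, [/\ size w = n, {subset w <= color_pairs}
              & ~~ closed_colorable w].
Proof.
(* Colors 1 and 2 are used once each, so 0 occurs in both pairs of opposite vertices of the 4-cycle,
   but vertices from different pairs are adjacent. The other lengths are odd, where constant lists
   allow no proper coloring. *)
pose w4 := [:: (0, 1); (0, 2); (0, 1); (0, 2)].
have witness w : [&& all (mem color_pairs) w & ~~ closed_colorable w] ->
    exists w', [/\ size w' = size w, {subset w' <= color_pairs}
                 & ~~ closed_colorable w'].
  by case/andP => /allP sub_w bad_w; exists w.
move=> n_small; have [->|[->|[->|->]]] :
  n = 3 \/ n = 4 \/ n = 5 \/ n = 7 by lia.
- by apply: (witness (nseq 3 (0, 1))); vm_compute.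
- by apply: (witness w4); vm_compute.
- by apply: (witness (nseq 5 (0, 1))); vm_compute.
- by apply: (witness (nseq 7 (0, 1))); vm_compute.
Qed.

(** * Passing between words and list assignments *)

Section Enumeration.

Variables (T : finType) (s : seq T).
Hypotheses (uniq_s : uniq s) (mem_s : forall v, v \in s).

Lemma card_set_enumeration (P : pred T) : #|[set v | P v]| = count P s.
Proof.
rewrite cardsE cardE -size_filter; apply/perm_size/uniq_perm.
- exact: enum_uniq.
- exact: filter_uniq.
- by move=> v; rewrite mem_enum mem_filter mem_s andbT.
Qed.

Lemma balanced_enumeration (L : T -> {set 'I_4}) (q : T -> nat * nat)
    (f : T -> 'I_4) :
    (forall v c, (c \in L v) = pair_has c (q v)) ->
  (forall c, halves (multiplicity L c) #|[set v | f v == c]|) <->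
  balanced (map q s) [seq val (f v) | v <- s].
Proof.
move=> L_q.
have countE (c : 'I_4) : (count (pair_has c) (map q s) = multiplicity L c)
    * (count_mem (val c) [seq val (f v) | v <- s] = #|[set v | f v == c]|).
  rewrite /multiplicity !card_set_enumeration !count_map.
  by split; apply: eq_count => v /=; rewrite ?L_q.
split=> [H | /balancedP H c]; last first.
  by have := H c (ltn_ord c); rewrite !countE.
apply/balancedP => x lt_x4.
by have := H (Ordinal lt_x4); rewrite -!countE.
Qed.

End Enumeration.

Lemma all2_map (S A B : Type) (r : A -> B -> bool) (g : S -> A) (h : S -> B)
    (s : seq S) :
  all2 r (map g s) (map h s) = all (fun v => r (g v) (h v)) s.
Proof. by elim: s => //= v s ->. Qed.

Definition pair_set (p : nat * nat) : {set 'I_4} :=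
  [set x : 'I_4 | pair_has x p].

Lemma card_pair_set (p : nat * nat) : p \in color_pairs -> #|pair_set p| = 2.
Proof.
move=> p_pairs.
rewrite (card_set_enumeration (enum_uniq 'I_4)) => [|v]; last by rewrite mem_enum.
rewrite -[count _ _]/(count (preim val (pair_has^~ p)) (enum 'I_4)).
rewrite -count_map val_enum_ord.
by move: p_pairs; rewrite !inE => /or4P[|||/or3P[]] /eqP->.
Qed.

Lemma pair_setP (A : {set 'I_4}) :
  #|A| = 2 -> exists2 p, p \in color_pairs & A = pair_set p.
Proof.
move/eqP/cards2P => [a [b [neq_ab ->]]].
wlog lt_ab : a b neq_ab / a < b.
  move=> H; case: (ltngtP a b) => [lt_ab|lt_ba|eq_ab].
  - exact: H.
  - by rewrite setUC; apply: H; rewrite // eq_sym.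
  - by case/eqP: neq_ab; apply: val_inj.
exists (val a, val b).
  case: a b lt_ab {neq_ab} => [a a4] [b b4] /=.
  by case: a a4 => [|[|[|[|a]]]] //; case: b b4 => [|[|[|[|b]]]].
by apply/setP => x; rewrite !inE.
Qed.

(** Reads [w] as lists along a spanning path [s]. The graph may have edges outside [s]; the last
    conclusion covers them, in particular the closing edge of a cycle. *)
Lemma choosable_enumeration (T : finType) (adj : rel T) (s : seq T)
    (w : seq (nat * nat)) :
    uniq s -> (forall v, v \in s) -> sorted adj s ->
    size w = size s -> {subset w <= color_pairs} ->
    proportionally_choosable adj 2 4 ->
  exists f : T -> nat,
    [/\ map f s \in colorings w, balanced w (map f s)
      & forall u v, adj u v -> f u != f v].
Proof.
move=> uniq_s mem_s path_s size_w sub_w.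
pose q v := nth (0, 1) w (index v s).
have map_q : map q s = w.
  apply: (@eq_from_nth _ (0, 1)) => [|i]; rewrite size_map // => lt_i.
  case: s lt_i @q uniq_s {mem_s path_s size_w} => // x s lt_i q uniq_s.
  by rewrite (nth_map x) // /q index_uniq.
have q_pairs v : q v \in color_pairs.
  by apply/sub_w/mem_nth; rewrite size_w index_mem.
have L_q v (c : 'I_4) : (c \in pair_set (q v)) = pair_has c (q v).
  by rewrite inE.
case/(_ (pair_set \o q)) => [v | f [f_L f_proper f_bal]].
  exact: card_pair_set.
exists (val \o f); split.
- rewrite mem_colorings -{1}map_q all2_map; apply/andP; split.
    by apply/allP => v _; have := f_L v; rewrite inE.
  by rewrite sorted_map; apply: sub_sorted path_s => u v /f_proper.
- rewrite -map_q; apply/(balanced_enumeration uniq_s mem_s f L_q) => c.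
  apply/halvesP; case: (boolP (c \in palette (pair_set \o q))) => [/f_bal //|].
  (* A color outside the palette has both counts equal to 0. *)
  move=> c_out; left.
  have no_list v : c \notin pair_set (q v).
    by apply: contra c_out => c_v; apply/bigcupP; exists v.
  rewrite /multiplicity !eq_card0 // => v; rewrite !inE.
    by apply/negbTE; have := no_list v; rewrite inE.
  by apply/eqP => f_v; have := no_list v; rewrite -f_v f_L.
- by move=> u v /f_proper.
Qed.

(** * Structure of choosable graphs *)

(* Around a vertex of degree 3 the list {0, 1} forces three equal colors. *)
Lemma choosable_degree (T : finType) (adj : rel T) (x a b c : T) :
    proportionally_choosable adj 2 4 ->
  adj x a -> adj x b -> adj x c -> ~~ uniq [:: a; b; c].
Proof.
move=> choose_adj xa xb xc; apply/negP => uniq_abc.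
pose X := [set v in [:: x; a; b; c]].
pose q v := if v \in X then (0, 1) else (2, 3).
have [v|f [f_L f_proper f_bal]] := choose_adj (pair_set \o q).
  by apply: card_pair_set; rewrite /q; case: ifP.
have X_color v : v \in X -> val (f v) = 0 \/ val (f v) = 1.
  by move=> Xv; have := f_L v; rewrite inE /= /q Xv => /orP[]/eqP; auto.
have opp v : adj x v -> v \in X -> val (f v) = 1 - val (f x).
  move=> /f_proper; rewrite -val_eqE => neq_f /X_color.
  have : x \in X by rewrite !inE eqxx.
  move/X_color; move: neq_f => /=; lia.
have Xa : a \in X by rewrite !inE eqxx ?orbT.
have Xb : b \in X by rewrite !inE eqxx ?orbT.
have Xc : c \in X by rewrite !inE eqxx ?orbT.
have fb : f b = f a by apply: val_inj; rewrite (opp b) // (opp a).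
have fc : f c = f a by apply: val_inj; rewrite (opp c) // (opp a).
have pal : f a \in palette (pair_set \o q).
  by apply/bigcupP; exists a => //; apply: f_L.
(* Only the at most four vertices of [X] can list [f a], which allows two uses, but [a], [b] and [c]
   all take it. *)
move/halvesP: (f_bal _ pal) => /andP[_].
have : 3 <= #|[set v | f v == f a]|.
  have card_abc : #|[set v in [:: a; b; c]]| = 3.
    by rewrite cardsE (card_uniqP _).
  apply: (@leq_trans #|[set v in [:: a; b; c]]|); first by rewrite card_abc.
  apply/subset_leq_card/subsetP => v; rewrite !inE.
  by case/or3P => /eqP-> ; rewrite ?fb ?fc.
have : multiplicity (pair_set \o q) (f a) <= 4.
  apply: (@leq_trans #|X|); last first.
    by rewrite cardsE (leq_trans (card_size _)).
  apply/subset_leq_card/subsetP => v; rewrite !inE /= /q.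
  case: ifP => [|_]; first by rewrite !inE.
  by rewrite /pair_has /=; case: (X_color a Xa) => /= ->.
by lia.
Qed.

(** An inner vertex of [s] already has two neighbors on [s], so a chord can only join the two ends:
    the graph is a path or a cycle. *)
Lemma max_degree2_spanning_path (T : finType) (adj : rel T) :
    symmetric adj -> connected_graph adj ->
    (forall x a b c, adj x a -> adj x b -> adj x c -> ~~ uniq [:: a; b; c]) ->
  exists s : seq T, [/\ s != [::], uniq s, forall v, v \in s, sorted adj s
    & forall x i j, i.+1 < j < size s -> adj (nth x s i) (nth x s j) ->
        i = 0 /\ j.+1 = size s].
Proof.
move=> sym_adj [T_gt0 conn_adj] deg_adj.
(* A longest path s is spanning: by the degree bound, a vertex outside s can only
   be adjacent to an endpoint, and would then extend s. *)
pose P n := [exists t : n.-tuple T, uniq t && sorted adj t].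
have [x0 _] : exists x, x \in T by apply/card_gt0P.
have P1 : exists n, P n.
  by exists 1; apply/existsP; exists [tuple x0].
have P_max n : P n -> n <= #|T|.
  case/existsP => t /andP[uniq_t _].
  by rewrite -(size_tuple t) -(card_uniqP uniq_t) max_card.
case: (ex_maxnP P1 P_max) => n /existsP[t /andP[uniq_t path_t]] max_n.
have {}max_n s : uniq s -> sorted adj s -> size s <= size t.
  move=> uniq_s path_s; rewrite size_tuple; apply: max_n.
  by apply/existsP; exists (in_tuple s); rewrite uniq_s.
move: (tval t) uniq_t path_t max_n => {n t} s uniq_s path_s max_s.
have s_gt0 : 0 < size s by apply: (max_s [:: x0]).
have nth_inj x i j : i < size s -> j < size s -> nth x s i = nth x s j -> i = j.
  by move=> lt_i lt_j /eqP; rewrite nth_uniq // => /eqP.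
have adj_succ x i : i.+1 < size s -> adj (nth x s i) (nth x s i.+1).
  by move=> lt_i; apply: (sortedP x path_s).
have adj_pred x i : 0 < i < size s -> adj (nth x s i) (nth x s i.-1).
  by case: i => // i /adj_succ; rewrite sym_adj.
have inner_nbhd x i v : 0 < i -> i.+1 < size s -> adj (nth x s i) v ->
    v = nth x s i.-1 \/ v = nth x s i.+1.
  move=> i_gt0 lt_i adj_iv.
  have lt_i' := ltnW lt_i.
  have adj_ip : adj (nth x s i) (nth x s i.-1).
    by apply: adj_pred; rewrite i_gt0.
  have := deg_adj _ _ _ _ adj_ip (adj_succ x i lt_i) adj_iv.
  rewrite /= !inE andbT !negb_and !negbK.
  rewrite nth_uniq //; last exact: leq_ltn_trans (leq_pred i) lt_i'.
  have -> : (i.-1 == i.+1) = false by lia.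
  by case/orP => /eqP->; [left|right].
have mem_s v : v \in s.
  (* Being nonempty and closed under adjacency, [s] fills the connected graph. *)
  have closed_s : closed adj (mem s).
    apply: (intro_closed (sym_connect_sym sym_adj)) => a b adj_ab a_s.
    apply: contraT => b_s.
    move: (a_s) (adj_ab) => /(nthP a)[i lt_i <-].
    case: (posnP i) => [-> | i_gt0] adj_ib.
      have := max_s (b :: s); rewrite /= b_s uniq_s ltnn.
      case: (s) path_s s_gt0 adj_ib => //= y s' -> _.
      by rewrite sym_adj => -> /(_ isT isT).
    case: (ltnP i.+1 (size s)) => [lt_i1 | le_i].
      case: (inner_nbhd a i b i_gt0 lt_i1 adj_ib) => b_nth; move: b_s.
        by rewrite b_nth mem_nth // (leq_ltn_trans (leq_pred i)).
      by rewrite b_nth mem_nth.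
    have := max_s (rcons s b); rewrite rcons_uniq b_s uniq_s size_rcons ltnn.
    have last_s : i = (size s).-1.
      by apply/eqP; rewrite -eqSS prednK // eqn_leq lt_i.
    move: adj_ib; rewrite last_s nth_last.
    case: (s) path_s s_gt0 => //= y s'.
    by rewrite rcons_path => -> _ -> /(_ isT isT).
  rewrite -[_ \in s]/(v \in mem s).
  have x_s : nth x0 s 0 \in mem s by apply: mem_nth.
  by rewrite -(closed_connect closed_s (conn_adj (nth x0 s 0) v)).
exists s; split=> //; first by rewrite -size_eq0 -lt0n.
move=> x i j /andP[lt_ij lt_j] adj_ij.
split.
  case: (posnP i) => // i_gt0.
  have lt_i := ltn_trans lt_ij lt_j.
  by have [] := inner_nbhd x i _ i_gt0 lt_i adj_ij => /nth_inj eq_j;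
    have := eq_j lt_j; lia.
case: (ltnP j.+1 (size s)) => [lt_j1|]; last by lia.
rewrite sym_adj in adj_ij.
have j_gt0 : 0 < j by lia.
have lt_i := ltn_trans (ltnW lt_ij) lt_j.
by have [] := inner_nbhd x j _ j_gt0 lt_j1 adj_ij => /nth_inj eq_i;
  have := eq_i lt_i; lia.
Qed.

(** * Recognizing paths and coloring the short ones *)

Lemma path_iso_enumeration (T : finType) (adj : rel T) (s : seq T) :
    uniq s -> (forall v, v \in s) ->
    (forall x i j, i < size s -> j < size s ->
       adj (nth x s i) (nth x s j) = (i.+1 == j) || (j.+1 == i)) ->
  graph_iso adj (@path_graph (size s)).
Proof.
move=> uniq_s mem_s adj_s.
have lt_index v : index v s < size s by rewrite index_mem.
exists (fun v => Ordinal (lt_index v)) => [|u v]; last first.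
  by have := adj_s u _ _ (lt_index u) (lt_index v); rewrite !nth_index.
apply: inj_card_bij => [u v [eq_uv] | ].
  by rewrite -(nth_index u (mem_s u)) eq_uv nth_index.
by rewrite card_ord -(card_uniqP uniq_s) subset_leq_card //; apply/subsetP.
Qed.

(** The lists read along the path form a word, and a balanced coloring of that word is carried back
    to the graph through [h]. *)
Lemma colorable_choosable_path (T : finType) (adj : rel T) (n : nat) :
    graph_iso adj (@path_graph n) -> all colorable (words n) ->
  proportionally_choosable adj 2 4.
Proof.
case=> h [g hK gK] adj_h /allP color_n L card_L.
pose s := map g (enum 'I_n).
have size_s : size s = n by rewrite size_map size_enum_ord.
have uniq_s : uniq s by rewrite map_inj_uniq ?enum_uniq //; apply: can_inj gK.
have mem_s v : v \in s by rewrite -(hK v) map_f // mem_enum.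
have index_s v : index v s = h v.
  by rewrite -{1}(hK v) index_map ?index_enum_ord //; apply: can_inj gK.
have list_v v : exists p, (p \in color_pairs) && (L v == pair_set p).
  by have [p p_pairs ->] := pair_setP (card_L v); exists p; rewrite p_pairs /=.
pose q v := xchoose (list_v v).
have q_pairs v : q v \in color_pairs by case/andP: (xchooseP (list_v v)).
have L_q v (c : 'I_4) : (c \in L v) = pair_has c (q v).
  by case/andP: (xchooseP (list_v v)) => _ /eqP {1}->; rewrite inE.
have : map q s \in words n.
  rewrite -{1}size_s -(size_map q); apply: mem_words => p /mapP[v _ ->].
  exact: q_pairs.
case/color_n/hasP => c; rewrite mem_colorings => /andP[q_c proper_c] bal_c.
have size_c : size c = n.
  by move: q_c; rewrite all2E size_map size_s => /andP[/eqP].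
have f_list v : pair_has (nth 0 c (h v)) (q v).
  have nth_s : nth v s (h v) = v by rewrite -index_s nth_index.
  move: q_c; rewrite all2E => /andP[_ /(all_nthP ((0, 1), 0))/(_ (h v))].
  rewrite size_zip size_map size_s size_c minnn ltn_ord => /(_ isT).
  rewrite nth_zip /=; last by rewrite size_map size_s size_c.
  by rewrite (nth_map v) ?size_s // nth_s.
(* The default of [inord] is never reached, since the lists contain only colors below 4. *)
pose f v : 'I_4 := inord (nth 0 c (h v)).
have val_f v : val (f v) = nth 0 c (h v).
  rewrite /f /= inordK //; have := f_list v; move: (q_pairs v).
  by rewrite !inE => /or4P[|||/or3P[]] /eqP-> /orP[] /eqP ->.
have map_f : [seq val (f v) | v <- s] = c.
  apply: (@eq_from_nth _ 0) => [|i]; rewrite size_map size_s // => lt_i.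
  rewrite (nth_map (g (Ordinal lt_i))) ?size_s // val_f -index_s.
  by rewrite index_uniq ?size_s.
have proper_succ u v : (h u).+1 = h v -> f u != f v.
  move=> h_uv; rewrite -val_eqE /= !val_f -h_uv.
  by apply: (sortedP 0 proper_c); rewrite size_c h_uv.
exists f; split.
- by move=> v; rewrite L_q val_f.
- move=> u v; rewrite -adj_h => /orP[] /eqP; first exact: proper_succ.
  by rewrite eq_sym; apply: proper_succ.
- move=> x _; apply/halvesP; move: x.
  by apply/(balanced_enumeration uniq_s mem_s f L_q); rewrite map_f.
Qed.

(** A finite check, over 6^7 words in the largest case. *)
Lemma colorable_words (n : nat) :
  1 <= n <= 5 \/ n = 7 -> all colorable (words n).
Proof.
move=> n_small; have [->|[->|[->|[->|[->|->]]]]] :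
  n = 1 \/ n = 2 \/ n = 3 \/ n = 4 \/ n = 5 \/ n = 7 by lia.
all: by vm_compute.
Qed.

Theorem theorem12 (T : finType) (adj : rel T)
    (simple_adj : simple_graph adj) (connected_adj : connected_graph adj) :
  proportionally_choosable adj 2 4 <->
  exists2 n : nat,
    1 <= n <= 5 \/ n = 7 & graph_iso adj (@path_graph n).
Proof.
split=> [choose_adj | [n n_small iso_n]]; last first.
  exact: colorable_choosable_path iso_n (colorable_words n_small).
have [sym_adj irr_adj] := simple_adj.
have [] := max_degree2_spanning_path sym_adj connected_adj.
  by move=> x a b c; apply: choosable_degree.
move=> s [s_neq0 uniq_s mem_s path_s chord_s].
have n_small : 1 <= size s <= 5 \/ size s = 7.
  have s_gt0 : 0 < size s by rewrite lt0n size_eq0.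
  case: (boolP ((size s == 6) || (8 <= size s))) => [n_large|]; last by lia.
  have [|w [size_w sub_w bad_w]] := @uncolorable_word (size s); first by lia.
  have [f [f_w f_bal _]] :=
    choosable_enumeration uniq_s mem_s path_s size_w sub_w choose_adj.
  by case/hasP: bad_w; exists (map f s).
(* Such an edge would close a cycle of length 3, 4, 5 or 7, each of which has a bad closed word. *)
have open_s x : 2 < size s -> ~~ adj (nth x s 0) (nth x s (size s).-1).
  move=> s_gt2; apply/negP => adj_ends.
  have [|w [size_w sub_w]] := @closed_uncolorable_word (size s); first by lia.
  have [f [f_w f_bal f_proper]] :=
    choosable_enumeration uniq_s mem_s path_s size_w sub_w choose_adj.
  case/hasP; exists (map f s) => //; rewrite f_bal.
  by rewrite -nth0 -nth_last size_map !(nth_map x) ?f_proper //; lia.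
have chordless x i j : i < j < size s ->
    adj (nth x s i) (nth x s j) = (i.+1 == j).
  move=> /andP[lt_ij lt_j]; apply/idP/eqP => [adj_ij | <-]; last first.
    by apply: (sortedP x path_s); lia.
  case: (ltngtP i.+1 j) => // [lt_i1j|]; last by lia.
  have [|i0 j_last] := chord_s x i j _ adj_ij; first by rewrite lt_i1j.
  have s_gt2 : 2 < size s by lia.
  by move: (open_s x s_gt2); rewrite -j_last -i0 adj_ij.
exists (size s) => //; apply: path_iso_enumeration => // x i j lt_i lt_j.
case: (ltngtP i j) => [lt_ij|lt_ji|->].
- by rewrite chordless ?lt_ij //; lia.
- by rewrite sym_adj chordless ?lt_ji //; lia.
- by rewrite irr_adj; lia.
Qed.
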